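(* Let $H$ be a Hilbert space and let $S,T$ be two densely defined unbounded operators on $H$ with respective domains $D(S)$ and $D(T)$. Assume that $$T\subset S^*S \quad\text{and}\quad T\subset SS^*.$$ Let $D\subset D(T)$ (so that $D\subset D(S^*S)\cap D(SS^* )$) be a dense linear subspace of $H$. (1) Assume that $D$ is a core for one of the two operators $S^*S$, $SS^*$ (for example, for $S^*S$). If $S$ is closed, then $S$ is normal. (2) If $S$ is not closed, then its closure $\overline{S}$ is normal if $D$ is a core for $S^*\overline{S}$.
   Context: Operators are linear and not necessarily bounded (''unbounded'' means not necessarily bounded). $T\subset R$ means that $R$ extends $T$: $D(T)\subset D(R)$ and $Tx=Rx$ for $x\in D(T)$. Products carry their natural domains: $D(AB)=\{x\in D(B): Bx\in D(A)\}$. $\overline{S}$ denotes the closure of a closable operator $S$. A densely defined closed operator $N$ is normal if $NN^*=N^*N$ (with equality of domains). A linear subspace $D\subset D(A)$ is a core for a closed operator $A$ if the closure of the restriction $A|_D$ equals $A$. *)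

(* Defs.v *)
From mathcomp Require Import all_boot all_order all_algebra.
From mathcomp Require Import complex.
From mathcomp Require Import all_classical all_reals all_analysis.

Set Implicit Arguments.
Unset Strict Implicit.
Unset Printing Implicit Defensive.

Import Order.TTheory GRing.Theory Num.Theory.
Import numFieldNormedType.Exports.

Local Open Scope classical_set_scope.
Local Open Scope ring_scope.
Local Open Scope complex_scope.

(* Complex Hilbert spaces. The inner product is linear in its first argument
   and conjugate-linear in its second one. Norms take values in R[i]. *)
Record hilbertType (R : realType) := Hilbert {
  hilbert_sort :> completeNormedModType R[i];
  inner : {dot hilbert_sort for @Num.conj R[i]};
  inner_norm : forall x : hilbert_sort, inner x x = `|x| ^+ 2 }.

(* A partially defined map on H; the values of [op_fun A] outside [dom A] are
   irrelevant, and operators are to be compared with [op_eq], not with [=]. *)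
Record partialop (H : Type) := PartialOp { dom : set H; op_fun :> H -> H }.

Section Operators.
Context {R : realType} {H : hilbertType R}.
Implicit Types (A B N : partialop H) (D : set H).

Definition linsubspace D : Prop := submod_closed (mem D).

Definition linear_op A : Prop :=
  linsubspace (dom A) /\
  forall (a : R[i]) (x y : H), dom A x -> dom A y ->
    A (a *: x + y) = a *: A x + A y.

Definition densely_defined A : Prop := dense (dom A).

Definition op_sub A B : Prop :=
  dom A `<=` dom B /\ forall x, dom A x -> A x = B x.

Definition op_eq A B : Prop :=
  dom A = dom B /\ forall x, dom A x -> A x = B x.

Definition op_mul A B : partialop H :=
  PartialOp [set x | dom B x /\ dom A (B x)] (fun x => A (B x)).

Definition op_restrict A D : partialop H := PartialOp D A.

Definition op_graph A : set (H * H)%type := [set p | dom A p.1 /\ p.2 = A p.1].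

Definition closed_op A : Prop := closed (op_graph A).

Definition closable A : Prop :=
  forall x y z : H, closure (op_graph A) (x, y) -> closure (op_graph A) (x, z) ->
    y = z.

(* For closable A, the value chosen by [xget] is the only possible one. *)
Definition op_closure A : partialop H :=
  PartialOp [set x | exists y, closure (op_graph A) (x, y)]
       (fun x => xget 0 [set y | closure (op_graph A) (x, y)]).

Definition adjoint_rel A (y z : H) : Prop :=
  forall x, dom A x -> inner H (A x) y = inner H x z.

(* For densely defined A, the value chosen by [xget] is the only possible
   one. *)
Definition adjoint A : partialop H :=
  PartialOp [set y | exists z, adjoint_rel A y z]
       (fun y => xget 0 [set z | adjoint_rel A y z]).

Definition normal_op N : Prop :=
  [/\ linear_op N, densely_defined N, closed_op N
    & op_eq (op_mul N (adjoint N)) (op_mul (adjoint N) N)].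

Definition core D A : Prop :=
  [/\ closed_op A, linsubspace D, D `<=` dom A
    & op_eq (op_closure (op_restrict A D)) A].

End Operators.

(* Main.v *)
Require Import Defs.
From mathcomp Require Import all_boot all_order all_algebra.
From mathcomp Require Import complex.
From mathcomp Require Import all_classical all_reals all_analysis.
From mathcomp Require Import ring.

(** Suppose first that S is closed. Write A for S^*S and B for SS^*, in either
    order, with D a core for A. Both operators are positive, and both 1 + A and
    1 + B are onto; positivity gives |x| <= |x + Bx|, so (1 + B)^-1 is an
    everywhere defined contraction.

    Since A and B agree on D, this contraction sends (1 + A)u to u for every u
    in D. The core property extends that identity to all of dom A by
    continuity, so A is a restriction of B. As 1 + A is already onto and 1 + B
    is injective, B cannot be a proper extension, and A = B: S is normal
    ([op_eq_of_core], [normal_of_core]).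

    That 1 + S^*S and 1 + SS^* are onto is von Neumann's argument: every point
    (a, b) of H x H is the sum of its projection (x, Sx) on the closed graph of
    S and of a vector (a - x, b - Sx) orthogonal to the graph, which says that
    S^*(b - Sx) = x - a ([adjoint_graph_decomposition]). The points (h, 0) and
    (0, h) give the two ranges. The projection is a minimiser of the distance
    to the graph ([closed_subspace_projection]), the parallelogram identity
    making minimising families Cauchy.

    If S is not closed, dom S^* contains the dense set dom T, which makes S
    closable ([closable_of_dense_adjoint]). The closure of S has the same
    adjoint as S, and the closed case applies to it. *)

Set Implicit Arguments.
Unset Strict Implicit.
Unset Printing Implicit Defensive.

Import Order.TTheory GRing.Theory Num.Theory.
Import numFieldNormedType.Exports.

Local Open Scope classical_set_scope.
Local Open Scope ring_scope.
Local Open Scope complex_scope.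

Section HilbertSpace.
Context {R : realType} {H : hilbertType R}.
Implicit Types (x y z u v : H) (G D : set H).
Local Notation "''[' u , v ]" := (inner H u v) : ring_scope.

(** * Inner product and norm *)

Lemma innerC u v : '[v, u] = Num.conj '[u, v].
Proof. by rewrite hermC expr0 mul1r. Qed.

Lemma inner_normB_scale t u v : `|u - t *: v| ^+ 2 =
  `|u| ^+ 2 + `|t| ^+ 2 * `|v| ^+ 2
    - (Num.conj t * '[u, v] + t * Num.conj '[u, v]).
Proof.
rewrite -!inner_norm dnormB dnormZ linearZr_LR /=.
by rewrite rmorphM/= conjCK.
Qed.

Lemma inner_cauchy_schwarz u v : `|'[u, v]| <= `|u| * `|v|.
Proof.
have [->|v0] := eqVneq v 0; first by rewrite linear0r normr0 mulr_ge0.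
have nv0 : `|v| != 0 by rewrite normr_eq0.
rewrite -(@ler_pXn2r _ 2) ?nnegrE ?mulr_ge0// exprMn -subr_ge0.
(* The part of u orthogonal to v has a nonnegative norm. *)
have : 0 <= `|v| ^+ 2 * `|u - ('[u, v] / `|v| ^+ 2) *: v| ^+ 2.
  by rewrite mulr_ge0// exprn_ge0.
congr (0 <= _); rewrite inner_normB_scale normf_div normrX normr_id.
rewrite rmorphM fmorphV rmorphXn /= (@conj_Creal _ `|v|) ?normr_real//.
by rewrite expr_div_n normCK; field.
Qed.

Lemma inner_continuousl z : continuous (fun x : H => '[x, z] : R[i]^o).
Proof.
move=> x; apply/cvgrPdist_lt => e e0.
have d0 : 0 < e / (`|z| + 1) by rewrite divr_gt0// ltr_wpDl.
near=> y; rewrite -linearBl; apply: le_lt_trans (inner_cauchy_schwarz _ _) _.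
apply: (@le_lt_trans _ _ (`|x - y| * (`|z| + 1))).
  by rewrite ler_wpM2l// lerDl.
rewrite -ltr_pdivlMr; last exact: ltr_wpDl.
near: y.
by move: (e / _) d0; apply/cvgrPdist_lt.
Unshelve. all: by end_near. Qed.

Lemma closed_zeros (T : topologicalType) (f : T -> R[i]^o) :
  continuous f -> closed [set x | f x = 0].
Proof.
move=> fc; apply: (@preimage_closed _ _ f [set 0]) => [x _|]; first exact: fc.
apply: (@accessible_closed_set1 R[i]^o).
by apply: hausdorff_accessible; exact: norm_hausdorff.
Qed.

Lemma dense_orthogonal D z : dense D -> (forall x, D x -> '[x, z] = 0) -> z = 0.
Proof.
move=> dD zD; apply/eqP; rewrite -(dnorm_eq0 (inner H)); apply/eqP.
have cl := closed_zeros (@inner_continuousl z).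
have [//|nz] := pselect ('[z, z] = 0).
have [|x [/= nx Dx]] := dD _ _ (closed_openC cl); first by exists z.
by case: nx; apply: zD.
Qed.

(** * Projection on a closed subspace of the product *)

Lemma closure_pairP (A : set (H * H)) (p : H * H) :
  closure A p <-> forall e : R[i], 0 < e ->
    exists a, [/\ A a, `|p.1 - a.1| < e & `|p.2 - a.2| < e].
Proof.
split=> [clp e e0|clp B].
  have [|a [Aa [pa1 pa2]]] := clp (ball p e); first exact: nbhsx_ballx.
  by exists a; move: pa1 pa2; rewrite -!ball_normE.
rewrite -nbhs_ballE => -[e /= e0 peB].
have [a [Aa pa1 pa2]] := clp e e0; exists a; split=> //; apply: peB.
by split; rewrite -ball_normE.
Qed.

Lemma linsubspaceP D : linsubspace D <->
  D 0 /\ forall a x y, D x -> D y -> D (a *: x + y).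
Proof.
split=> -[D0 DD]; split.
- by move: D0; rewrite inE.
- by move=> a x y Dx Dy; have := DD a x y; rewrite !inE; apply.
- by rewrite inE.
- by move=> a x y; rewrite !inE => Dx Dy; apply: DD.
Qed.

(** Completeness in the form that the minimisation below provides: squared
    distances are small on the members of the filter. *)
Lemma cauchy_filter_sqr (T : Type) (F : set_system T) (f : T -> H) :
  ProperFilter F ->
  (forall e : R[i], 0 < e -> exists2 A, F A &
     forall p q, A p -> A q -> `|f p - f q| ^+ 2 <= e) ->
  exists l : H, f @ F --> l.
Proof.
move=> FF fF; apply/cvg_ex; apply: cauchy_cvg; apply: cauchy_exP => e e0.
have [|A FA fA] := fF (e ^+ 2 / 2); first by rewrite divr_gt0// exprn_gt0.
have [p Ap] := filter_ex FA; exists (f p).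
change (F (f @^-1` ball (f p) e)); apply: filterS FA => q Aq.
rewrite -ball_normE /= -(@ltr_pXn2r _ 2) ?nnegrE ?normr_ge0 ?(ltW e0)//.
apply: le_lt_trans (fA _ _ Ap Aq) _.
by rewrite ltr_pdivrMr// ltr_pMr ?exprn_gt0// ltr1n.
Qed.

(** The parallelogram identity for x - u and x - v: two points almost as close
    to x as possible are close to each other if their midpoint is no closer. *)
Lemma norm_parallelogram u v x : `|u - v| ^+ 2 =
  2 * `|x - u| ^+ 2 + 2 * `|x - v| ^+ 2 - 4 * `|x - 2^-1 *: (u + v)| ^+ 2.
Proof.
set y := x - u; set z := x - v.
have -> : u - v = z - y by rewrite /z /y opprB [RHS]addrC addrA subrK.
have -> : x - 2^-1 *: (u + v) = 2^-1 *: (y + z).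
  rewrite /y /z addrACA -opprD scalerBr -[x + x]mulr2n -[x *+ 2]scaler_nat.
  by rewrite scalerA mulVf ?scale1r// pnatr_eq0.
rewrite normrZ; move: y z => y z.
rewrite exprMn normfV normr_nat -!inner_norm dnormB dnormD.
by rewrite (innerC y z) conjCK; field.
Qed.

(** The norm of the product type is the maximum of the norms of the two
    components, so H x H is not a Hilbert space for it, although its topology
    and completeness are those of the Hilbert sum; the Hilbert-sum norm and
    inner product are therefore written out by components. The projection of c
    is the limit of the filter of the elements of G that almost minimise the
    distance to c. *)
Lemma closed_subspace_projection (G : set (H * H)) (c : H * H) :
  G 0 -> (forall a p q, G p -> G q -> G (a *: p + q)) -> closed G ->
  exists2 p, G p & forall q, G q -> '[c.1 - p.1, q.1] + '[c.2 - p.2, q.2] = 0.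
Proof.
move=> G0 Glin Gcl.
pose E (p : H * H) : R[i] := `|c.1 - p.1| ^+ 2 + `|c.2 - p.2| ^+ 2.
have E_ge0 p : 0 <= E p by rewrite addr_ge0// exprn_ge0.
have ReE p : (complex.Re (E p))%:C = E p by rewrite RRe_real// ger0_real.
(* R[i] is only partially ordered, so the infimum is taken in R. *)
pose d : R[i] := (inf [set complex.Re (E p) | p in G])%:C.
have lbE : has_lbound [set complex.Re (E p) | p in G].
  by exists 0 => _ [p _ <-]; rewrite -ler0c ReE.
have d_le p : G p -> d <= E p.
  by move=> Gp; rewrite -ReE lecR; apply: ge_inf => //; exists p.
pose B (e : R[i]) := [set p | G p /\ E p < d + e].
have B_ex e : 0 < e -> B e !=set0.
  move=> e0; have eE : (complex.Re e)%:C = e by rewrite RRe_real// gtr0_real.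
  have [||_ [p Gp <-] Hp] := @inf_adherent _ [set complex.Re (E p) | p in G]
    (complex.Re e) _ (conj _ lbE).
  - by rewrite -ltcR eE.
  - by exists (complex.Re (E 0)), 0.
  - by exists p; split=> //; rewrite -ReE /d -eE -rmorphD ltcR.
(* A filter of almost minimisers, instead of a minimising sequence. *)
pose F := filter_from [set e : R[i] | 0 < e] B.
have FF : ProperFilter F.
  apply: filter_from_proper => //; apply: filter_from_filter.
    by exists 1; exact: ltr01.
  move=> e f e0 f0; have ef := real_comparable (gtr0_real e0) (gtr0_real f0).
  exists (Order.min e f); first by rewrite /= comparable_lt_min// e0.
  move=> p [Gp Ep]; split; split=> //; apply: lt_le_trans Ep _;
    by rewrite lerD2l comparable_ge_min// lexx ?orbT.
have B_close e p q : B e p -> B e q ->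
    `|p.1 - q.1| ^+ 2 + `|p.2 - q.2| ^+ 2 <= 4 * e.
  move=> [Gp Ep] [Gq Eq].
  have Gm : G (2^-1 *: (p + q)).
    rewrite -[_ *: _]addr0; apply: (Glin) => //.
    by rewrite -[p]scale1r; apply: Glin.
  rewrite (norm_parallelogram p.1 q.1 c.1) (norm_parallelogram p.2 q.2 c.2).
  rewrite [X in X <= _](_ : _ =
    2 * (E p + E q) - 4 * E (2^-1 *: (p + q))); last first.
    by rewrite /E /=; ring.
  rewrite lerBlDr; apply: (@le_trans _ _ (2 * ((d + e) + (d + e)))).
    by rewrite ler_wpM2l// lerD// ltW.
  have -> : 2 * (d + e + (d + e)) = 4 * e + 4 * d by ring.
  by rewrite lerD2l ler_wpM2l// d_le.
have FB e : 0 < e -> F (B e) by exists e.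
have [l1 Fl1] : exists l : H, (fun p : H * H => p.1) @ F --> l.
  apply: cauchy_filter_sqr => e e0; exists (B (e / 4)).
    by apply: FB; rewrite divr_gt0.
  move=> p q Bp Bq; have := B_close _ _ _ Bp Bq.
  rewrite mulrC divfK ?pnatr_eq0//.
  by apply: le_trans; rewrite lerDl exprn_ge0.
have [l2 Fl2] : exists l : H, (fun p : H * H => p.2) @ F --> l.
  apply: cauchy_filter_sqr => e e0; exists (B (e / 4)).
    by apply: FB; rewrite divr_gt0.
  move=> p q Bp Bq; have := B_close _ _ _ Bp Bq.
  rewrite mulrC divfK ?pnatr_eq0//.
  by apply: le_trans; rewrite lerDr exprn_ge0.
have FG : F G by exists 1 => //= p [].
have Gl : G (l1, l2).
  apply: (@closed_cvg _ (H * H)%type F _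
    (fun p => (p.1, p.2)) G Gcl _ (l1, l2)).
    by move: FG; apply: filterS; case.
  exact: cvg_pair.
have El : E (l1, l2) = d.
  have FE : (E p : R[i]^o) @[p --> F] --> (E (l1, l2) : R[i]^o).
    by apply: cvgD; apply: (@cvgM R[i]); apply: cvg_norm; apply: cvgB => //;
      apply: cvg_cst.
  have Fd : (E p : R[i]^o) @[p --> F] --> (d : R[i]^o).
    apply/cvgrPdist_lt => e e0; exists e => // p [Gp Ep].
    by rewrite distrC ger0_norm ?subr_ge0 ?d_le// ltrBlDl.
  apply: (cvg_unique _ FE Fd); exact: norm_hausdorff.
exists (l1, l2) => // q Gq /=.
have split_diff t x l v : x - (t *: v + l) = x - l - t *: v.
  by rewrite opprD addrCA addrC.
set w1 := c.1 - l1; set w2 := c.2 - l2; set b := _ + _.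
pose N := `|q.1| ^+ 2 + `|q.2| ^+ 2.
have N0 : 0 <= N by rewrite addr_ge0// exprn_ge0.
have N1 : 0 < 1 + N by rewrite ltr_wpDr.
(* Moving from the minimiser along s b q changes the squared distance by
   |b|^2 s (s N - 2), which is negative unless b = 0. The best step is 1 / N;
   the denominator 1 + N also covers q = 0. *)
pose s := (1 + N)^-1.
have s0 : 0 < s by rewrite invr_gt0.
have sN : s * N - 2 < 0.
  rewrite subr_lt0 mulrC ltr_pdivrMr// mulrDr mulr1 ltr_pwDl//.
  by rewrite ler_peMl// ler1n.
have E_shift : E (s * b *: q + (l1, l2)) =
    E (l1, l2) + `|b| ^+ 2 * (s * (s * N - 2)).
  rewrite /E /= !split_diff -/w1 -/w2 !inner_normB_scale.
  rewrite normrM exprMn (ger0_norm (ltW s0)) rmorphM /=.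
  rewrite (@conj_Creal _ s) ?gtr0_real// (normCK b).
  rewrite (_ : Num.conj b = Num.conj '[w1, q.1] + Num.conj '[w2, q.2]).
    by rewrite /b /N; ring.
  by rewrite -rmorphD.
have : d <= E (s * b *: q + (l1, l2)) by apply: d_le; apply: Glin.
rewrite E_shift El lerDl => b_ge0.
have [//|b0] := eqVneq b 0.
move: b_ge0; rewrite lt_geF// pmulr_rlt0 ?exprn_gt0 ?normr_gt0//.
by rewrite pmulr_rlt0.
Qed.

(** * Partial operators and adjoints *)

Implicit Types (A B S : partialop H).

Lemma adjointP S y : dom (adjoint S) y -> adjoint_rel S y (adjoint S y).
Proof. by move=> [z Hz]; apply: (xgetPex 0 (ex_intro _ z Hz)). Qed.

Lemma adjoint_unique S y z : densely_defined S -> adjoint_rel S y z ->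
  dom (adjoint S) y /\ adjoint S y = z.
Proof.
move=> dS yz; have dy : dom (adjoint S) y by exists z.
split=> //; apply/eqP; rewrite -subr_eq0; apply/eqP.
apply: (dense_orthogonal dS) => x Sx.
by rewrite linearBr /= -(yz x Sx) -(adjointP dy Sx) subrr.
Qed.

Lemma adjoint_linear S : densely_defined S -> linear_op (adjoint S).
Proof.
move=> dS.
have rel_lin a x y z t : adjoint_rel S x z -> adjoint_rel S y t ->
    adjoint_rel S (a *: x + y) (a *: z + t).
  by move=> xz yt u Su; rewrite !linearDr !linearZr_LR /= xz// yt.
split; last first.
  move=> a x y /adjointP dx /adjointP dy.
  by have [] := adjoint_unique dS (rel_lin a _ _ _ _ dx dy).
apply/linsubspaceP; split.
  by exists 0 => u _; rewrite !linear0r.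
move=> a x y /adjointP dx /adjointP dy.
by exists (a *: adjoint S x + adjoint S y); apply: rel_lin.
Qed.

Lemma op_closureP A x : dom (op_closure A) x ->
  closure (op_graph A) (x, op_closure A x).
Proof.
by move=> [y cl]; exact: (@xgetPex _ 0 [set y | closure (op_graph A) (x, y)]
  (ex_intro _ y cl)).
Qed.

Lemma linear_op0 S : linear_op S -> S 0 = 0.
Proof.
move=> [/linsubspaceP[S0 _] /(_ (-1) 0 0 S0 S0)].
by rewrite scaler0 add0r scaleN1r addNr.
Qed.

Lemma op_mul_linear A B : linear_op A -> linear_op B -> linear_op (op_mul A B).
Proof.
move=> [/linsubspaceP[A0 Alin] AZ] linB.
have [/linsubspaceP[B0 Blin] BZ] := linB.
split; last first.
  by move=> a x y [Bx ABx] [By ABy] /=; rewrite BZ// AZ.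
apply/linsubspaceP; split; first by split=> //=; rewrite linear_op0.
move=> a x y [Bx ABx] [By ABy]; split=> /=; first exact: Blin.
by rewrite BZ//; apply: Alin.
Qed.

Lemma graph_linear S : linear_op S -> op_graph S 0 /\
  forall a p q, op_graph S p -> op_graph S q -> op_graph S (a *: p + q).
Proof.
move=> linS; have [/linsubspaceP[S0 Slin] SZ] := linS.
split; first by split=> //=; rewrite linear_op0.
move=> a [x1 x2] [y1 y2] [/= dx ->] [/= dy ->].
by split=> /=; [apply: Slin|rewrite SZ].
Qed.

(** * Ranges and positivity *)

(** A pair (- z, y) is orthogonal to the graph of S exactly when z is a value of
    the adjoint at y: this is the splitting of (a, b) along the closed graph and
    its orthogonal complement. *)
Lemma adjoint_graph_decomposition S (a b : H) : linear_op S -> closed_op S ->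
  exists2 x, dom S x & adjoint_rel S (b - S x) (x - a).
Proof.
move=> linS clS; have [G0 Glin] := graph_linear linS.
have [[x y] [/= dx ->] orth] := closed_subspace_projection (a, b) G0 Glin clS.
exists x => // u du; have /= := orth (u, S u) (conj du erefl).
move=> /addr0_eq Hu; rewrite innerC -Hu.
by rewrite rmorphN /= -innerC -linearNr opprB.
Qed.

Lemma adjSS_onto S h : linear_op S -> densely_defined S -> closed_op S ->
  exists2 x, dom (op_mul (adjoint S) S) x & x + adjoint S (S x) = h.
Proof.
move=> linS dS clS; have [x dx xh] := adjoint_graph_decomposition h 0 linS clS.
have /(adjoint_unique dS)[dSx SSx] : adjoint_rel S (S x) (h - x).
  move=> u du; have /eqP := xh u du.
  by rewrite sub0r linearNr eqr_oppLR -linearNr opprB => /eqP.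
by exists x => //; rewrite SSx addrC subrK.
Qed.

Lemma SadjS_onto S h : linear_op S -> densely_defined S -> closed_op S ->
  exists2 y, dom (op_mul S (adjoint S)) y & y + S (adjoint S y) = h.
Proof.
move=> linS dS clS; have [x dx] := adjoint_graph_decomposition 0 h linS clS.
rewrite subr0 => /(adjoint_unique dS)[dy Sy].
by exists (h - S x); [split; rewrite ?Sy|rewrite Sy subrK].
Qed.

Lemma adjSS_ge0 S x : dom (op_mul (adjoint S) S) x ->
  0 <= '[adjoint S (S x), x].
Proof.
by move=> [dx /adjointP dSx]; rewrite innerC -dSx// -innerC dnorm_ge0.
Qed.

Lemma SadjS_ge0 S y : dom (op_mul S (adjoint S)) y ->
  0 <= '[S (adjoint S y), y].
Proof. by move=> [dy dSy]; rewrite (adjointP dy)// dnorm_ge0. Qed.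

Lemma norm_le_add_ge0 x y : 0 <= '[y, x] -> `|x| <= `|x + y|.
Proof.
move=> yx; rewrite -(@ler_pXn2r _ 2) ?nnegrE//.
rewrite -!inner_norm dnormD -addrA lerDl addr_ge0//.
by rewrite innerC conjCK addr_ge0// -innerC innerC conjC_ge0.
Qed.

(** By positivity of B, the resolvent (1 + B)^-1 is a contraction. It inverts
    1 + A on the core, hence on all of dom A, so A is a restriction of B; since
    1 + A is onto and 1 + B injective, it is not a proper one. *)
Lemma op_eq_of_core A B D : core D A -> D `<=` dom B ->
  (forall x, D x -> A x = B x) -> linear_op B ->
  (forall x, dom B x -> 0 <= '[B x, x]) ->
  (forall h, exists2 x, dom A x & x + A x = h) ->
  (forall h, exists2 x, dom B x & x + B x = h) -> op_eq A B.
Proof.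
move=> [_ _ DA [clD clE]] DB AB linB B_ge0 Aonto Bonto.
have [/linsubspaceP[_ Blin] BZ] := linB.
have B_sub x y : dom B x -> dom B y -> dom B (x - y) /\ B (x - y) = B x - B y.
  move=> dx dy; rewrite -[x - y]addrC -scaleN1r; split; first exact: Blin.
  by rewrite BZ// scaleN1r addrC.
have B_contract x y : dom B x -> dom B y ->
    `|x - y| <= `|(x + B x) - (y + B y)|.
  move=> dx dy; have [dxy Bxy] := B_sub _ _ dx dy.
  by rewrite opprD addrACA -Bxy; apply: norm_le_add_ge0; apply: B_ge0.
have AsubB x : dom A x -> dom B x /\ A x = B x.
  move=> dx; have [w dw wE] := Bonto (x + A x).
  suff xw : x = w.
    by subst w; split=> //; apply: (addrI x).
  have clx : dom (op_closure (op_restrict A D)) x by rewrite clD.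
  have := op_closureP clx; rewrite (clE _ clx).
  move=> /closure_pairP cl; apply/eqP; have [//|xw] := boolP (x == w).
  (* Choose u in D near x for the graph norm: u is then near w as well, because
     (1 + B)u = (1 + A)u is near (1 + A)x = (1 + B)w. *)
  have r0 : 0 < `|x - w| / 3 by rewrite divr_gt0// normr_gt0 subr_eq0.
  have [[u v] [[/= Du ->] /= xu Axu]] := cl _ r0.
  have xw3 : `|x - w| = `|x - w| / 3 + (`|x - w| / 3 + `|x - w| / 3) by field.
  have : `|x - w| < `|x - w|; last by rewrite ltxx.
  rewrite [X in _ < X]xw3; apply: le_lt_trans (ler_distD u x w) _.
  apply: ltrD => //.
  apply: le_lt_trans (B_contract u w (DB _ Du) dw) _.
  rewrite wE -AB// distrC opprD addrACA.
  exact: le_lt_trans (ler_normD _ _) (ltrD _ _).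
split=> [|x /AsubB[]//]; apply/seteqP; split=> [x /AsubB[]//|x dx].
have [y dy yE] := Aonto (x + B x); have [By ABy] := AsubB _ dy.
suff -> : x = y by [].
apply/eqP; rewrite -subr_eq0 -normr_eq0; apply/eqP/le_anti.
rewrite normr_ge0 andbT (le_trans (B_contract _ _ dx By))//.
by rewrite -ABy yE subrr normr0.
Qed.

(** * Closures of operators *)

(** For fixed y and z, <v, y> = <u, z> is a closed condition on (u, v). *)
Lemma adjoint_rel_closure S u v y z : adjoint_rel S y z ->
  closure (op_graph S) (u, v) -> '[v, y] = '[u, z].
Proof.
move=> yz; set f := fun p : H * H => '[p.2, y] - '[p.1, z] : R[i]^o.
have fc : continuous f.
  move=> p; apply: cvgB.
    apply: (@continuous_comp _ _ _ snd (fun v => '[v, y] : R[i]^o)).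
      exact: cvg_snd.
    exact: inner_continuousl.
  apply: (@continuous_comp _ _ _ fst (fun v => '[v, z] : R[i]^o)).
    exact: cvg_fst.
  exact: inner_continuousl.
have gf : op_graph S `<=` [set p | f p = 0].
  by move=> [a b] [/= da ->]; rewrite /f /= (yz a da) subrr.
move=> /(closureS gf); rewrite -(closure_id _).1; last exact: closed_zeros.
by move=> /subr0_eq.
Qed.

(** If (x, y) and (x, z) lie in the closed graph, <y, v> and <z, v> both equal
    <x, S^*v>, so y - z is orthogonal to dom S^*. *)
Lemma closable_of_dense_adjoint S : dense (dom (adjoint S)) -> closable S.
Proof.
move=> dS' x y z xy xz; apply/eqP; rewrite -subr_eq0; apply/eqP.
apply: (dense_orthogonal dS') => v /adjointP dv.
rewrite innerC linearBl rmorphB /= (adjoint_rel_closure dv xy).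
by rewrite (adjoint_rel_closure dv xz) subrr.
Qed.

Section Closure.
Context (S : partialop H) (clS : closable S).

Lemma op_graph_closure : op_graph (op_closure S) = closure (op_graph S).
Proof.
apply/seteqP; split=> [[x y] [/= dx ->]|[x y] cl]; first exact: op_closureP.
have dx : dom (op_closure S) x by exists y.
by split=> //=; apply: (clS cl (op_closureP dx)).
Qed.

Lemma op_closure_closed : closed_op (op_closure S).
Proof. by rewrite /closed_op op_graph_closure; apply: closed_closure. Qed.

Lemma sub_op_closure : op_sub S (op_closure S).
Proof.
have grS x : dom S x -> closure (op_graph S) (x, S x).
  by move=> dx; apply: subset_closure.
split=> [x dx|x dx]; first by exists (S x); apply: grS.
by apply: (clS (grS _ dx) (op_closureP _)); exists (S x); apply: grS.
Qed.

Lemma op_closure_linear : linear_op S -> linear_op (op_closure S).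
Proof.
move=> linS; have [G0 Glin] := graph_linear linS.
have lin a p q : closure (op_graph S) p -> closure (op_graph S) q ->
    closure (op_graph S) (a *: p + q).
  move=> /closure_pairP clp /closure_pairP clq; apply/closure_pairP => e e0.
  have a0 : 0 < `|a| + 1 by rewrite ltr_wpDl.
  have lin_close (u v u' v' : H) : `|u - u'| < e / 2 / (`|a| + 1) ->
      `|v - v'| < e / 2 -> `|a *: u + v - (a *: u' + v')| < e.
    move=> uu' vv'; rewrite opprD addrACA -scalerBr [e]splitr.
    apply: le_lt_trans (ler_normD _ _) _; apply: ltrD => //.
    rewrite normrZ; move: uu'; rewrite ltr_pdivlMr// => /(le_lt_trans _); apply.
    by rewrite mulrC ler_wpM2l// lerDl.
  have [|p' [Gp' p1 p2]] := clp (e / 2 / (`|a| + 1)).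
    by rewrite !divr_gt0.
  have [|q' [Gq' q1 q2]] := clq (e / 2); first by rewrite divr_gt0.
  exists (a *: p' + q'); split; first exact: Glin.
  - apply: lin_close p1 q1.
  - apply: lin_close p2 q2.
split; last first.
  move=> a x y /op_closureP clx /op_closureP cly.
  have cl := lin a _ _ clx cly.
  apply/esym/(clS cl)/op_closureP.
  by exists (a *: op_closure S x + op_closure S y).
apply/linsubspaceP; split; first by exists 0; apply: subset_closure.
move=> a x y /op_closureP clx /op_closureP cly.
by exists (a *: op_closure S x + op_closure S y); apply: (lin a _ _ clx cly).
Qed.

Lemma adjoint_op_closure : adjoint (op_closure S) = adjoint S.
Proof.
have E : adjoint_rel (op_closure S) = adjoint_rel S.
  apply/funext => y; apply/funext => z; apply/propext; split=> yz x dx.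
    by have [dxx ->] := sub_op_closure; rewrite ?yz//; apply: dxx.
  exact: adjoint_rel_closure yz (op_closureP dx).
by rewrite /adjoint E.
Qed.

End Closure.

(** * Normality *)

Lemma op_eq_sym A B : op_eq A B -> op_eq B A.
Proof. by move=> [dAB AB]; split=> [//|x dx]; rewrite AB// dAB. Qed.

Lemma normal_of_core S D : linear_op S -> densely_defined S -> closed_op S ->
  D `<=` dom (op_mul (adjoint S) S) -> D `<=` dom (op_mul S (adjoint S)) ->
  (forall x, D x -> adjoint S (S x) = S (adjoint S x)) ->
  core D (op_mul (adjoint S) S) \/ core D (op_mul S (adjoint S)) ->
  normal_op S.
Proof.
move=> linS dS clS D1 D2 Deq coreD; split=> //.
have linS' := adjoint_linear dS.
case: coreD => coreD; [apply: op_eq_sym|];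
  apply: (op_eq_of_core coreD) => //.
- exact: op_mul_linear.
- exact: SadjS_ge0.
- by move=> h; apply: adjSS_onto.
- by move=> h; apply: SadjS_onto.
- by move=> x Dx; apply/esym/Deq.
- exact: op_mul_linear.
- exact: adjSS_ge0.
- by move=> h; apply: SadjS_onto.
- by move=> h; apply: adjSS_onto.
Qed.

End HilbertSpace.

Theorem theorem2 (R : realType) (H : hilbertType R) (S T : partialop H) (D : set H)
    (linS : linear_op S) (linT : linear_op T)
    (denseS : densely_defined S) (denseT : densely_defined T)
    (T_sub_adjSS : op_sub T (op_mul (adjoint S) S))
    (T_sub_SadjS : op_sub T (op_mul S (adjoint S)))
    (subspD : linsubspace D) (D_sub_T : D `<=` dom T) (denseD : dense D) :
  (core D (op_mul (adjoint S) S) \/ core D (op_mul S (adjoint S)) ->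
     closed_op S -> normal_op S) /\
  (~ closed_op S ->
     closable S /\
     (core D (op_mul (adjoint S) (op_closure S)) -> normal_op (op_closure S))).
Proof.
have [d1 T1] := T_sub_adjSS; have [d2 T2] := T_sub_SadjS.
have Deq x : D x -> adjoint S (S x) = S (adjoint S x).
  by move=> /D_sub_T Tx; rewrite -[LHS](T1 x Tx) -[RHS](T2 x Tx).
split=> [coreD clS|_].
  apply: (@normal_of_core _ _ S D) => //.
  - by move=> x /D_sub_T /d1.
  - by move=> x /D_sub_T /d2.
have clS : closable S.
  apply: closable_of_dense_adjoint => O O0 oO.
  by have [x [Ox /d2[]]] := denseT O O0 oO; exists x.
split=> // coreD; have [dSS SS] := sub_op_closure clS.
have adjE := adjoint_op_closure clS.
apply: (@normal_of_core _ _ _ D); rewrite ?adjE.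
- exact: op_closure_linear.
- by move=> O O0 oO; have [x [Ox /dSS]] := denseS O O0 oO; exists x.
- exact: op_closure_closed.
- by have [] := coreD.
- by move=> x /D_sub_T /d2[dx dSx]; split=> //; apply: dSS.
- move=> x Dx; have [Sx _] := d1 _ (D_sub_T _ Dx).
  by have [_ S'x] := d2 _ (D_sub_T _ Dx); rewrite -SS// -SS// Deq.
- by left.
Qed.
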